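(* ESSD can be solved in $O((2k+2)^{n}\cdot m)$ time, where $n$ is the number of clients, $m$ the number of days and $k$ the equity parameter.
   Context: Equitable Scheduling model: there are $n$ clients and $m$ days; on each day $j$ each client $i$ has one job with integer processing time $p_{i,j}$ and integer deadline $d_{i,j}$, to be processed non-preemptively on a single machine. A schedule for day $j$ is a permutation $\sigma_j$ of $\{1,\dots,n\}$; the completion time of client $i$'s job on day $j$ is $C_{i,j}=\sum_{i_0:\sigma_j(i_0)\le\sigma_j(i)}p_{i_0,j}$. Client $i$ is satisfied on day $j$ if $C_{i,j}\le d_{i,j}$. Given $k\in\{0,\dots,m\}$, a set of schedules is $k$-equitable if every client is satisfied on at least $k$ days. ESSD (Equitable Scheduling with Single Deadlines): the special case where on each day $j$ all jobs share a common deadline, $d_{i,j}=d_j$; decide whether a $k$-equitable set of schedules exists. *)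

(* Defs.v *)
From Stdlib Require Import ZArith.
From Stdlib Require List.
From mathcomp Require Import all_boot all_fingroup.

Set Implicit Arguments.
Unset Strict Implicit.
Unset Printing Implicit Defensive.

(* n clients ('I_n), m days ('I_m); p i j = processing time of client i's    *)
(* job on day j; d j = common deadline on day j.                             *)

Definition completion (n m : nat) (p : 'I_n -> 'I_m -> nat) (s : {perm 'I_n})
  (i : 'I_n) (j : 'I_m) : nat :=
  \sum_(i0 : 'I_n | s i0 <= s i) p i0 j.

Definition satisfied (n m : nat) (p : 'I_n -> 'I_m -> nat) (d : 'I_m -> nat)
  (sigma : 'I_m -> {perm 'I_n}) (i : 'I_n) (j : 'I_m) : bool :=
  completion p (sigma j) i j <= d j.

Definition k_equitable (n m k : nat) (p : 'I_n -> 'I_m -> nat) (d : 'I_m -> nat)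
  (sigma : 'I_m -> {perm 'I_n}) : Prop :=
  forall i : 'I_n, k <= #|[set j : 'I_m | satisfied p d sigma i j]|.

Definition ESSD (n m k : nat) (p : 'I_n -> 'I_m -> nat) (d : 'I_m -> nat) : Prop :=
  exists sigma : 'I_m -> {perm 'I_n}, k_equitable k p d sigma.

Inductive instr : Type :=
| IConst (r : Z) (z : Z)
| IAdd (r a b : Z)
| ISub (r a b : Z)
| ILoad (r a : Z)
| IStore (a r : Z)
| IJpos (r : Z) (l : nat)
| IJmp (l : nat).

Definition program := list instr.

Record state := State { pc : nat ; mem : Z -> Z }.

Definition upd (M : Z -> Z) (a v : Z) : Z -> Z :=
  fun x => if Z.eqb x a then v else M x.

Definition halted (P : program) (s : state) : bool := length P <= pc s.

Definition step (P : program) (s : state) : state :=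
  let M := mem s in
  let nx := (pc s).+1 in
  match List.nth_error P (pc s) with
  | None => s
  | Some (IConst r z) => State nx (upd M r z)
  | Some (IAdd r a b) => State nx (upd M r (M a + M b)%Z)
  | Some (ISub r a b) => State nx (upd M r (M a - M b)%Z)
  | Some (ILoad r a) => State nx (upd M r (M (M a)))
  | Some (IStore a r) => State nx (upd M (M a) (M r))
  | Some (IJpos r l) => if Z.ltb 0 (M r) then State l M else State nx M
  | Some (IJmp l) => State l M
  end.

Definition exec (P : program) (t : nat) (s : state) : state := iter t (step P) s.

(* Input encoding: M[0] = n, M[1] = m, M[2] = k,
   M[3 + j*n + i] = p i j   (i < n, j < m),
   M[3 + n*m + j] = d j     (j < m),
   all other cells 0.  Execution starts at pc = 0. *)
Definition pval (n m : nat) (p : 'I_n -> 'I_m -> nat) (i j : nat) : nat :=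
  match @insub _ (fun x => x < n) 'I_n i, @insub _ (fun x => x < m) 'I_m j with
  | Some i', Some j' => p i' j'
  | _, _ => 0
  end.

Definition dval (m : nat) (d : 'I_m -> nat) (j : nat) : nat :=
  match @insub _ (fun x => x < m) 'I_m j with
  | Some j' => d j'
  | None => 0
  end.

Definition init_mem (n m k : nat) (p : 'I_n -> 'I_m -> nat) (d : 'I_m -> nat)
  : Z -> Z :=
  fun a =>
    if Z.eqb a 0 then Z.of_nat n
    else if Z.eqb a 1 then Z.of_nat m
    else if Z.eqb a 2 then Z.of_nat k
    else if (Z.leb 3 a && Z.ltb a (3 + Z.of_nat (n * m)))%bool then
      let t := Z.to_nat (a - 3) in Z.of_nat (pval p (t %% n) (t %/ n))
    else if (Z.leb (3 + Z.of_nat (n * m)) a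
             && Z.ltb a (3 + Z.of_nat (n * m) + Z.of_nat m))%bool then
      Z.of_nat (dval d (Z.to_nat (a - 3 - Z.of_nat (n * m))))
    else 0%Z.

Definition init_state (n m k : nat) (p : 'I_n -> 'I_m -> nat) (d : 'I_m -> nat)
  : state := State 0 (init_mem k p d).

Definition decides_in (P : program) (n m k : nat) (p : 'I_n -> 'I_m -> nat)
  (d : 'I_m -> nat) (t : nat) : Prop :=
  let s := exec P t (init_state k p d) in
  halted P s /\
  ((mem s 0 = 1%Z /\ ESSD k p d) \/ (mem s 0 = 0%Z /\ ~ ESSD k p d)).

(* Main.v *)
(* A set of clients can be satisfied together on day j iff its total processing
   time is at most d_j: schedule it first.  Since subsets of such sets are again
   such sets, every client may be assumed to be served on exactly k days, so the
   days can be processed in order while recording which vectors in {0..k}^n of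
   numbers of days served so far are reachable.  A step of one day chooses for
   each client a pair (x, x + s) with s in {0, 1} and x + s <= k; there are
   2k + 1 such pairs, hence (2k + 1)^n transitions.  On each day the machine
   lists all of them, client by client: the list for i + 1 clients consists of
   2k + 1 shifted copies of the list for i clients, so listing them costs a
   geometric sum O((2k + 1)^n), and each transition is then tested in constant
   time. *)

Require Import Defs.
From Stdlib Require Import ZArith Lia.
From mathcomp Require Import all_boot all_fingroup zify.

Set Implicit Arguments.
Unset Strict Implicit.
Unset Printing Implicit Defensive.

(** * Structured programs and their execution cost *)

Inductive com : Type :=
| Blk (l : seq instr)
| Seq (c1 c2 : com)
| If (r : Z) (c : com)
| While (r : Z) (c : com).

Definition straight (x : instr) : bool :=
  match x with IJpos _ _ | IJmp _ => false | _ => true end.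

Definition effect (M : Z -> Z) (x : instr) : Z -> Z :=
  match x with
  | IConst r z => upd M r z
  | IAdd r a b => upd M r (M a + M b)%Z
  | ISub r a b => upd M r (M a - M b)%Z
  | ILoad r a => upd M r (M (M a))
  | IStore a r => upd M (M a) (M r)
  | _ => M
  end.

Fixpoint csize (c : com) : nat :=
  match c with
  | Blk l => size l
  | Seq c1 c2 => csize c1 + csize c2
  | If _ c => (csize c).+2
  | While _ c => (csize c).+3
  end.

(* [compile off c] uses absolute jump targets and must be placed at [off]. *)
Fixpoint compile (off : nat) (c : com) : seq instr :=
  match c with
  | Blk l => l
  | Seq c1 c2 => compile off c1 ++ compile (off + csize c1) c2
  | If r c => [:: IJpos r off.+2, IJmp (off.+2 + csize c) & compile off.+2 c]
  | While r c =>
      [:: IJpos r off.+2, IJmp (off.+3 + csize c)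
        & rcons (compile off.+2 c) (IJmp off)]
  end.

Lemma size_compile off c : size (compile off c) = csize c.
Proof.
elim: c off => //= [c1 IH1 c2 IH2|_ c IH|_ c IH] off.
- by rewrite size_cat IH1 IH2.
- by rewrite IH.
- by rewrite size_rcons IH.
Qed.

Lemma nth_error_size_cat (T : Type) (a b : seq T) x :
  List.nth_error (a ++ x :: b) (size a) = Some x.
Proof. by elim: a. Qed.

Lemma length_size (T : Type) (l : seq T) : length l = size l.
Proof. by elim: l => //= _ l ->. Qed.

Arguments exec : simpl never.

(** Quantifying over the surrounding code [a] and [b] frees the fact from the position of [c], in
    spite of the absolute jump targets, so that runs of subprograms compose. *)
Definition runs (c : com) (M M' : Z -> Z) (t : nat) : Prop :=
  forall a b, exec (a ++ compile (size a) c ++ b) t (State (size a) M)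
              = State (size a + csize c) M'.

Lemma exec_add P t1 t2 s : exec P (t1 + t2) s = exec P t2 (exec P t1 s).
Proof. by rewrite /exec addnC iterD. Qed.

Lemma runs_blk l M :
  all straight l -> runs (Blk l) M (foldl effect M l) (size l).
Proof.
rewrite /runs /=; elim: l M => [|x l IH] M /= => [_ a b|/andP[sx sl] a b].
  by rewrite addn0.
rewrite -[(size l).+1]add1n exec_add -cat_rcons.
have -> : exec (rcons a x ++ l ++ b) 1 (State (size a) M)
          = State (size (rcons a x)) (effect M x).
  rewrite /exec /= /step cat_rcons nth_error_size_cat size_rcons.
  by case: x sx.
by rewrite IH // size_rcons addSnnS.
Qed.

Lemma runs_seq c1 c2 M M1 M2 t1 t2 :
  runs c1 M M1 t1 -> runs c2 M1 M2 t2 -> runs (Seq c1 c2) M M2 (t1 + t2).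
Proof.
move=> r1 r2 a b; rewrite exec_add /= -catA r1.
have := r2 (a ++ compile (size a) c1) b.
by rewrite size_cat size_compile -catA addnA.
Qed.

Lemma step_jpos a b r l M :
  step (a ++ IJpos r l :: b) (State (size a) M)
  = State (if Z.ltb 0 (M r) then l else (size a).+1) M.
Proof. by rewrite /step nth_error_size_cat /=; case: ifP. Qed.

Lemma step_jmp a b l M :
  step (a ++ IJmp l :: b) (State (size a) M) = State l M.
Proof. by rewrite /step nth_error_size_cat. Qed.

Lemma step_jmp_rcons a b x l M :
  step (a ++ [:: x, IJmp l & b]) (State (size a).+1 M) = State l M.
Proof. by rewrite -cat_rcons -(size_rcons a x) step_jmp. Qed.

Lemma runs_if_false r c M : (M r <= 0)%Z -> runs (If r c) M M 2.
Proof.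
move=> Mr a b; rewrite /exec /= step_jpos.
by rewrite (_ : Z.ltb 0 (M r) = false) ?step_jmp_rcons ?addSnnS; [|lia].
Qed.

Lemma runs_if_true r c M M' t :
  (0 < M r)%Z -> runs c M M' t -> runs (If r c) M M' (1 + t).
Proof.
move=> Mr rc a b; rewrite exec_add {2}/exec /= step_jpos.
rewrite (_ : Z.ltb 0 (M r) = true); last by lia.
set x := IJpos _ _; set y := IJmp _.
have := rc (a ++ [:: x; y]) b.
by rewrite size_cat -catA !addnS addn0 /= addSn.
Qed.

Lemma runs_while_false r c M : (M r <= 0)%Z -> runs (While r c) M M 2.
Proof.
move=> Mr a b; rewrite /exec /= step_jpos.
by rewrite (_ : Z.ltb 0 (M r) = false) ?step_jmp_rcons ?addSnnS; [|lia].
Qed.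

Lemma runs_while_true r c M M1 M2 t1 t2 :
  (0 < M r)%Z -> runs c M M1 t1 -> runs (While r c) M1 M2 t2 ->
  runs (While r c) M M2 (1 + (t1 + (1 + t2))).
Proof.
move=> Mr rc rw a b; rewrite exec_add {2}/exec /= step_jpos.
rewrite (_ : Z.ltb 0 (M r) = true); last by lia.
have := rw a b; rewrite /=.
set x := IJpos _ _; set y := IJmp _ => rw'.
rewrite exec_add -cats1.
have := rc (a ++ [:: x; y]) (IJmp (size a) :: b).
rewrite size_cat -catA !addnS addn0 /= -catA /= => ->.
rewrite exec_add {2}/exec /=.
have -> : step (a ++ [:: x, y & compile (size a).+2 c ++ IJmp (size a) :: b])
    (State ((size a).+2 + csize c) M1) = State (size a) M1.
  have := step_jmp (a ++ [:: x, y & compile (size a).+2 c]) b (size a) M1.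
  by rewrite size_cat /= size_compile -catA /= !addnS addSn.
by move: rw'; rewrite -cats1 -catA /= !addnS.
Qed.

(** The actual number of steps depends on the data through conditionals; [T] is an upper bound that
    does not. *)
Definition wp (c : com) (T : nat) (M : Z -> Z) (Q : (Z -> Z) -> Prop) : Prop :=
  exists M' t, [/\ t <= T, runs c M M' t & Q M'].

Lemma wp_blk l M (Q : (Z -> Z) -> Prop) :
  all straight l -> Q (foldl effect M l) -> wp (Blk l) (size l) M Q.
Proof.
move=> sl q; exists (foldl effect M l), (size l).
by split=> //; apply: runs_blk.
Qed.

Lemma wp_seq c1 c2 T1 T2 M Q :
  wp c1 T1 M (fun M1 => wp c2 T2 M1 Q) -> wp (Seq c1 c2) (T1 + T2) M Q.
Proof.
move=> [M1] [t1] [le1 r1] [M2] [t2] [le2 r2 q].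
by exists M2, (t1 + t2); split=> //; [apply: leq_add|apply: runs_seq r2].
Qed.

Lemma wp_if r c T M (Q : (Z -> Z) -> Prop) :
  ((0 < M r)%Z -> wp c T M Q) -> ((M r <= 0)%Z -> Q M) ->
  wp (If r c) (T + 2) M Q.
Proof.
move=> qt qf; case: (Z_lt_le_dec 0 (M r)) => Mr.
  have [M' [t [le_t rc q]]] := qt Mr.
  by exists M', (1 + t); split=> //; [lia | apply: runs_if_true].
by exists M, 2; split; [lia | apply: runs_if_false | apply: qf].
Qed.

Lemma wp_weaken c T T' M (Q Q' : (Z -> Z) -> Prop) :
  T <= T' -> wp c T M Q -> (forall M', Q M' -> Q' M') -> wp c T' M Q'.
Proof.
move=> le_T [M' [t [le_t r q]]] qq'; exists M', t.
by split=> //; [apply: leq_trans le_T | apply: qq'].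
Qed.

(** The invariant is indexed by the number of completed rounds, which fixes their total at [N]. Each
    round pays [2] for its test and its jump back; the last [2] is the failing test and the exit
    jump. *)
Lemma wp_while (Inv : nat -> (Z -> Z) -> Prop) (T : nat -> nat) N r c M
    (Q : (Z -> Z) -> Prop) :
  Inv 0 M ->
  (forall i M', i < N -> Inv i M' ->
     (0 < M' r)%Z /\ wp c (T i) M' (Inv i.+1)) ->
  (forall M', Inv N M' -> (M' r <= 0)%Z /\ Q M') ->
  wp (While r c) (\sum_(i < N) (T i + 2) + 2) M Q.
Proof.
move=> I0 step_inv fin.
(* Induction on the number [i] of rounds still to come. *)
have main i M' : i <= N -> Inv (N - i) M' ->
    wp (While r c) (\sum_(N - i <= l < N) (T l + 2) + 2) M' Q.
  elim: i M' => [|i IH] M' le_i inv.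
    rewrite subn0 in inv *; have [Mr q] := fin _ inv.
    by exists M', 2; split=> //; [lia | apply: runs_while_false].
  have lt_i : N - i.+1 < N by lia.
  have [Mr [M1 [t1 [le1 r1 inv1]]]] := step_inv _ _ lt_i inv.
  have eqi : (N - i.+1).+1 = N - i by lia.
  rewrite eqi in inv1; have [M2 [t2 [le2 r2 q]]] := IH _ (ltnW le_i) inv1.
  exists M2, (1 + (t1 + (1 + t2))); split=> //; last exact: runs_while_true r2.
  by rewrite big_ltn // eqi; lia.
by have := main N M (leqnn N); rewrite subnn big_mkord; apply.
Qed.

(** * Memory layout and symbolic execution *)

Arguments Z.add : simpl never.
Arguments Z.sub : simpl never.
Arguments Z.mul : simpl never.
Arguments Z.opp : simpl never.
Arguments Z.of_nat : simpl never.

(* Registers have addresses -1 to -26 and arrays addresses at most -100, so that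
   neither meets the input.  Four arrays are interleaved with stride 4: arrays
   0, 1, 2 list the transitions (code before, code after, processing time) and
   array 3 holds, one row per day, a 0/1 flag for each code. *)
Notation rZERO := (-1)%Z.
Notation rONE := (-2)%Z.
Notation rTWO := (-3)%Z.
Notation rFOUR := (-4)%Z.
Notation rDIG := (-5)%Z.
Notation rP := (-6)%Z.
Notation rD := (-7)%Z.
Notation rJ := (-8)%Z.
Notation rI := (-9)%Z.
Notation rLEN := (-10)%Z.
Notation rOFF0 := (-11)%Z.
Notation rOFF1 := (-12)%Z.
Notation rOFF2 := (-13)%Z.
Notation rQ := (-14)%Z.
Notation rPW := (-15)%Z.
Notation rA := (-16)%Z.
Notation rC := (-17)%Z.
Notation rRP := (-18)%Z.
Notation rWP := (-19)%Z.
Notation rT := (-20)%Z.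
Notation rU := (-21)%Z.
Notation rROW := (-22)%Z.
Notation rNEXT := (-23)%Z.
Notation rLIM := (-24)%Z.
Notation rANS := (-25)%Z.
Notation rNLEN := (-26)%Z.

Definition cell (M : Z -> Z) (t : Z) (y : nat) : Z :=
  M (-100 - t - 4 * Z.of_nat y)%Z.

(* Says nothing about the arrays. *)
Definition frame (l : seq Z) (M M' : Z -> Z) : Prop :=
  (forall a, (0 <= a)%Z -> M' a = M a) /\
  (forall r, (-100 < r < 0)%Z -> has (Z.eqb r) l = false -> M' r = M r).

Lemma frame_refl l M : frame l M M. Proof. by []. Qed.

Lemma frame_trans l M M1 M2 : frame l M M1 -> frame l M1 M2 -> frame l M M2.
Proof.
move=> [i1 r1] [i2 r2]; split=> [a a0|r rr rl]; first by rewrite i2 ?i1.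
by rewrite r2 ?r1.
Qed.

Lemma frame_sub l l' M M1 :
  all (fun r => has (Z.eqb r) l') l -> frame l M M1 -> frame l' M M1.
Proof.
move=> sub [i1 r1]; split=> // r rr rl; apply: r1 => //.
apply: contraFF rl; elim: l sub {i1} => //= x l IH /andP[xl /IH{}IH].
by case/orP=> [/Z.eqb_eq ->|/IH].
Qed.

(** * Copying a list of transitions with offsets *)

Definition copy_cell (off : Z) : seq instr :=
  [:: ILoad rT rRP; IAdd rT rT off; IStore rWP rT;
      ISub rRP rRP rONE; ISub rWP rWP rONE].

(** The last two subtractions step over the fourth interleaved cell, a flag that must survive. *)
Definition copy_entry : seq instr :=
  ISub rC rC rONE :: copy_cell rOFF0 ++ copy_cell rOFF1 ++ copy_cell rOFF2
  ++ [:: ISub rRP rRP rONE; ISub rWP rWP rONE].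

Definition copy_block : com := While rC (Blk copy_entry).

Lemma upd_same M a v : upd M a v a = v.
Proof. by rewrite /upd Z.eqb_refl. Qed.

Lemma upd_at M a v x : x = a -> upd M a v x = v.
Proof. by move=> ->; apply: upd_same. Qed.

Lemma upd_other M a v x : x <> a -> upd M a v x = M x.
Proof. by rewrite /upd => /Z.eqb_neq ->. Qed.

Lemma step_nil M : foldl effect M [::] = M. Proof. by []. Qed.

Lemma step_const M r z l :
  foldl effect M (IConst r z :: l) = foldl effect (upd M r z) l.
Proof. by []. Qed.

(** Naming the operands' values [va] and [vb] lets known equations replace lookups at once, which
    keeps the symbolic memory small. *)
Lemma step_add M r a b va vb l : M a = va -> M b = vb ->
  foldl effect M (IAdd r a b :: l) = foldl effect (upd M r (va + vb)%Z) l.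
Proof. by move=> <- <-. Qed.

Lemma step_sub M r a b va vb l : M a = va -> M b = vb ->
  foldl effect M (ISub r a b :: l) = foldl effect (upd M r (va - vb)%Z) l.
Proof. by move=> <- <-. Qed.

Lemma step_load M r a va v l : M a = va -> M va = v ->
  foldl effect M (ILoad r a :: l) = foldl effect (upd M r v) l.
Proof. by move=> <- <-. Qed.

Lemma step_store M r a va v l : M a = va -> M r = v ->
  foldl effect M (IStore a r :: l) = foldl effect (upd M va v) l.
Proof. by move=> <- <-. Qed.

Lemma frame_upd l M M' a v : frame l M M' ->
  (a <= -100)%Z \/ (a < 0)%Z /\ has (Z.eqb a) l ->
  frame l M (upd M' a v).
Proof.
move=> [i r] aP; split=> [x x0|x x0 xl].
  by rewrite upd_other ?i //; case: aP; lia.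
rewrite upd_other ?r // => xa; case: aP => [|[_]]; first lia.
by rewrite -xa xl.
Qed.

Ltac frames :=
  repeat (apply: frame_upd; last by [left; lia | right]);
  try assumption; try exact: frame_refl.

Ltac upds := repeat first
  [ rewrite upd_same
  | rewrite upd_other; last first; [first [discriminate | lia]|]
  | rewrite upd_at; last lia ].
Ltac rd := upds; first [eassumption | reflexivity].
Ltac step := first
  [ rewrite step_const
  | erewrite step_add; [|rd|rd]
  | erewrite step_sub; [|rd|rd]
  | erewrite step_load; [|rd|rd]
  | erewrite step_store; [|rd|rd] ].
Ltac symex := repeat step; rewrite step_nil.

(* Source and target may overlap only when they coincide, which happens for the
   copy with zero offsets. *)
Lemma wp_copy_block W len M :
  M rONE = 1%Z -> M rRP = (-100)%Z -> M rWP = (-100 - 4 * Z.of_nat W)%Z ->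
  M rC = Z.of_nat len -> W = 0 \/ len <= W ->
  wp copy_block (len * 20 + 2) M (fun M' =>
    [/\ frame [:: rT; rRP; rWP; rC] M M',
        (forall x, cell M' 3 x = cell M 3 x),
        M' rWP = (-100 - 4 * Z.of_nat (W + len))%Z,
        (forall y t, y < len -> (0 <= t <= 2)%Z ->
           cell M' t (W + y) = (cell M t y + M (rOFF0 - t))%Z) &
        (forall y t, ~ (W <= y < W + len) -> (0 <= t <= 2)%Z ->
           cell M' t y = cell M t y)]).
Proof.
move=> M1 MRP MWP MC HW.
pose Inv c M' := M' rC = Z.of_nat (len - c) /\
  M' rRP = (-100 - 4 * Z.of_nat c)%Z /\
    [/\ frame [:: rT; rRP; rWP; rC] M M',
        (forall x, cell M' 3 x = cell M 3 x),
        M' rWP = (-100 - 4 * Z.of_nat (W + c))%Z,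
        (forall y t, y < c -> (0 <= t <= 2)%Z ->
           cell M' t (W + y) = (cell M t y + M (rOFF0 - t))%Z) &
        (forall y t, ~ (W <= y < W + c) -> (0 <= t <= 2)%Z ->
           cell M' t y = cell M t y)].
have eqT : len * 20 + 2 = \sum_(i < len) (18 + 2) + 2.
  by rewrite sum_nat_const card_ord.
rewrite eqT.
apply: (@wp_while Inv (fun=> 18)).
- rewrite /Inv subn0 addn0; split=> //; split=> //; split=> //.
- move=> c M' ltc [M'C [M'RP [fr R M'WP new old]]].
  split; first by lia.
  apply: (@wp_blk copy_entry) => //.
  have M'1 : M' rONE = 1%Z by rewrite fr.2.
  (* Entry [c] is still the original one: the entries written so far run from [W] to [W + c - 1],
     and either [W = 0] or [c < len <= W]. *)
  have rd t : (0 <= t <= 2)%Z -> M' (-100 - t - 4 * Z.of_nat c)%Z = cell M t c.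
    by move=> tt; apply: old => //; lia.
  have o0 : M' rOFF0 = M rOFF0 by rewrite fr.2.
  have o1 : M' rOFF1 = M rOFF1 by rewrite fr.2.
  have o2 : M' rOFF2 = M rOFF2 by rewrite fr.2.
  rewrite /copy_entry /copy_cell ![_ ++ _]/=.
  symex.
  split; first by upds; lia.
  split; first by upds; lia.
  split.
  - by frames.
  - by move=> x; rewrite /cell; upds; apply: R.
  - by upds; lia.
  - move=> y t lty tt; rewrite /cell.
    have [->|ne] := eqVneq y c.
      have [->|[->|->]] : (t = 0 \/ t = 1 \/ t = 2)%Z by lia.
      - upds; have := rd 0%Z; rewrite /cell => <-; last by lia.
        by congr (M' _ + M _)%Z; lia.
      - upds; have := rd 1%Z; rewrite /cell => <-; last by lia.
        by congr (M' _ + M _)%Z; lia.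
      - upds; have := rd 2%Z; rewrite /cell => <-; last by lia.
        by congr (M' _ + M _)%Z; lia.
    have yc: y < c by lia.
    rewrite -new //.
    upds. done.
  - move=> y t ny tt; rewrite /cell; upds; apply: old => //; lia.
- move=> M' [M'C [_ [fr R M'WP new old]]]; split; first lia.
  by split.
Qed.

(** * Listing the transitions of one day *)

(** A digit is [b = 2x + s] with [x = b./2], [x + s = uphalf b] and [s = odd b]; [q] is the weight
    of the client's place in the codes, [w] the processing time. *)
Definition offset (q w b : nat) (t : Z) : Z :=
  (if t =? 0 then Z.of_nat (b./2 * q)
   else if t =? 1 then Z.of_nat (uphalf b * q) else Z.of_nat (odd b * w))%Z.

(* From one digit to the next, (offset 0, offset 1) becomes
   (offset 1, offset 0 + q) and offset 2 alternates between 0 and the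
   processing time. *)
Definition digit_body : com :=
  Seq (Blk [:: ISub rA rA rONE; IConst rRP (-100); IAdd rC rLEN rZERO;
               IAdd rNLEN rNLEN rLEN])
 (Seq copy_block
      (Blk [:: IAdd rT rOFF0 rZERO; IAdd rOFF0 rOFF1 rZERO;
               IAdd rOFF1 rT rQ; ISub rOFF2 rPW rOFF2])).

Definition extend_regs : seq Z :=
  [:: rT; rRP; rWP; rC; rA; rNLEN; rOFF0; rOFF1; rOFF2].

(** Block [0] is copied onto its source with zero offsets, and later blocks lie beyond it, so every
    block is made from the original list. The final [rOFF1] matters because for [D = 2k + 1] it is
    [(k + 1) * q], the weight of the next place, obtained without multiplication. *)
Lemma wp_extend len D q w M :
  M rONE = 1%Z -> M rZERO = 0%Z -> M rA = Z.of_nat D -> M rWP = (-100)%Z ->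
  M rLEN = Z.of_nat len -> M rNLEN = 0%Z ->
  M rOFF0 = 0%Z -> M rOFF1 = 0%Z -> M rOFF2 = 0%Z ->
  M rQ = Z.of_nat q -> M rPW = Z.of_nat w ->
  wp (While rA digit_body) (D * (len * 20 + 12) + 2) M (fun M' =>
    [/\ frame extend_regs M M', (forall x, cell M' 3 x = cell M 3 x),
        M' rNLEN = Z.of_nat (D * len), M' rOFF1 = Z.of_nat (uphalf D * q) &
        forall b y t, b < D -> y < len -> (0 <= t <= 2)%Z ->
          cell M' t (b * len + y) = (cell M t y + offset q w b t)%Z]).
Proof.
move=> M1 M0 MA MWP ML MNL MO0 MO1 MO2 MQ MPW.
pose Inv a M' := M' rA = Z.of_nat (D - a) /\
  M' rWP = (-100 - 4 * Z.of_nat (a * len))%Z /\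
  (forall y t, y < len -> (0 <= t <= 2)%Z -> cell M' t y = cell M t y) /\
  (forall t, (0 <= t <= 2)%Z -> M' (rOFF0 - t)%Z = offset q w a t) /\
    [/\ frame extend_regs M M', (forall x, cell M' 3 x = cell M 3 x),
        M' rNLEN = Z.of_nat (a * len), M' rOFF1 = Z.of_nat (uphalf a * q) &
        forall b y t, b < a -> y < len -> (0 <= t <= 2)%Z ->
          cell M' t (b * len + y) = (cell M t y + offset q w b t)%Z].
have -> : D * (len * 20 + 12) + 2 = \sum_(i < D) ((len * 20 + 10) + 2) + 2.
  by rewrite sum_nat_const card_ord -addnA.
apply: (@wp_while Inv (fun=> len * 20 + 10)).
- rewrite /Inv subn0 mul0n; split=> //; split=> //; split=> //; split=> //.
  move=> t tt.
  have [->|[->|->]] : (t = 0 \/ t = 1 \/ t = 2)%Z by lia.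
  + by rewrite MO0.
  + by rewrite (_ : (-11 - 1)%Z = rOFF1) // MO1.
  + by rewrite (_ : (-11 - 2)%Z = rOFF2) // MO2.
- move=> a M' lta [M'A [M'WP [orig [offs [fr R M'NL _ new]]]]].
  split; first by lia.
  have M'1 : M' rONE = 1%Z by rewrite fr.2.
  have M'0 : M' rZERO = 0%Z by rewrite fr.2.
  have M'L : M' rLEN = Z.of_nat len by rewrite fr.2.
  have M'Q : M' rQ = Z.of_nat q by rewrite fr.2.
  have M'PW : M' rPW = Z.of_nat w by rewrite fr.2.
  have M'O0 := offs 0%Z ltac:(lia).
  have M'O1 := offs 1%Z ltac:(lia).
  have M'O2 := offs 2%Z ltac:(lia).
  rewrite [(_ - _)%Z]/= in M'O0 M'O1 M'O2.
  have -> : len * 20 + 10 = 4 + ((len * 20 + 2) + 4) by lia.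
  apply: wp_seq; apply: (@wp_blk [:: _; _; _; _]) => //.
  symex.
  set M1' := upd _ _ _.
  have fr1 : frame extend_regs M M1' by frames.
  apply: wp_seq.
  apply: (wp_weaken (leqnn _)).
    apply: (@wp_copy_block (a * len) len); rewrite /M1'; upds; try done; try lia.
    by have [->|/leq_pmull] := posnP a; [left | right].
  move=> M2 [fr2 R2 M2WP M2new M2old].
  have rg r : (-100 < r < 0)%Z -> has (Z.eqb r) [:: rT; rRP; rWP; rC] = false ->
      M2 r = M1' r by apply: fr2.2.
  have M20 : M2 rZERO = 0%Z by rewrite rg // /M1'; upds.
  have M2Q : M2 rQ = Z.of_nat q by rewrite rg // /M1'; upds.
  have M2PW : M2 rPW = Z.of_nat w by rewrite rg // /M1'; upds.
  have M2O0 : M2 rOFF0 = M' rOFF0 by rewrite rg // /M1'; upds.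
  have M2O1 : M2 rOFF1 = M' rOFF1 by rewrite rg // /M1'; upds.
  have M2O2 : M2 rOFF2 = M' rOFF2 by rewrite rg // /M1'; upds.
  have M2A : M2 rA = Z.of_nat (D - a.+1) by rewrite rg // /M1'; upds; lia.
  have M2NL : M2 rNLEN = Z.of_nat (a.+1 * len) by rewrite rg // /M1'; upds; lia.
  have cM1 t y : (0 <= t <= 3)%Z -> cell M1' t y = cell M' t y.
    by move=> tt; rewrite /cell /M1'; upds.
  have oM1 t : (0 <= t <= 2)%Z -> M1' (rOFF0 - t)%Z = M' (rOFF0 - t)%Z.
    by move=> tt; rewrite /M1'; upds.
  rewrite M'O0 in M2O0; rewrite M'O1 in M2O1; rewrite M'O2 in M2O2.
  clearbody M1'.
  apply: (@wp_blk [:: _; _; _; _]) => //.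
  symex.
  have M2cells y t : y < len -> (0 <= t <= 2)%Z -> cell M2 t y = cell M t y.
    move=> yl tt; case: (posnP a) => [a0|a0].
      have := M2new y t yl tt; rewrite a0 mul0n add0n => ->.
      rewrite cM1; last lia.
      rewrite orig // oM1 // offs //.
      by rewrite a0 /offset /=; do 2?[case: ifP => _]; lia.
    rewrite M2old // ?cM1 ?orig //; first lia.
    by have := leq_pmull len a0; lia.
  split; first by upds.
  split; first by upds; rewrite M2WP; lia.
  split; first by move=> y t yl tt; rewrite -M2cells // /cell; upds.
  split.
    move=> t tt; rewrite /offset.
    have [->|[->|->]] : (t = 0 \/ t = 1 \/ t = 2)%Z by lia.
    + by upds; rewrite /offset /=; lia.
    + by upds; rewrite /offset /=; lia.
    + by upds; rewrite /offset /=; lia.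
  split.
  + apply: frame_trans fr1 _.
    have fr3 : frame extend_regs M1' M2 by apply: frame_sub fr2.
    by frames.
  + by move=> x; rewrite -R -cM1 // -R2 /cell; upds.
  + by upds.
  + by upds; rewrite /offset /=; lia.
  + move=> b y t ba yl tt.
    transitivity (cell M2 t (b * len + y)); first by rewrite /cell; upds.
    case: (ltngtP b a) => [lt_ba|gt|->].
    * rewrite M2old // ?cM1 ?new //; first lia.
      by have := leq_mul lt_ba (leqnn len); lia.
    * by lia.
    * by rewrite M2new // oM1 // offs // cM1 ?orig //; lia.
- move=> M' [M'A [_ [_ [_ [fr R M'NL M'O1 new]]]]].
  by split; first lia.
Qed.

(* The digit [b] of client [i] means: the client has been served [b./2] times
   before the day, and is served on that day iff [b] is odd. *)
Fixpoint trans (k : nat) (p : nat -> nat) (i u v w : nat) : Prop :=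
  match i with
  | 0 => [/\ u = 0, v = 0 & w = 0]
  | i'.+1 => exists b u' v' w', [/\ b <= 2 * k, trans k p i' u' v' w',
      u = u' + b./2 * k.+1 ^ i', v = v' + uphalf b * k.+1 ^ i' &
      w = w' + odd b * p i']
  end.

(* Codes are stored multiplied by 4, the stride of the interleaved arrays. *)
Definition entry (M : Z -> Z) (y u v w : nat) : Prop :=
  [/\ cell M 0 y = (4 * Z.of_nat u)%Z, cell M 1 y = (4 * Z.of_nat v)%Z &
      cell M 2 y = Z.of_nat w].

(** Soundness and completeness of the list; the order of its entries is left open, as the tests do
    not depend on it. *)
Definition table (k : nat) (p : nat -> nat) (i : nat) (M : Z -> Z) : Prop :=
  (forall y, y < (2 * k).+1 ^ i ->
     exists u v w, trans k p i u v w /\ entry M y u v w) /\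
  (forall u v w, trans k p i u v w ->
     exists2 y, y < (2 * k).+1 ^ i & entry M y u v w).

Lemma entry_ext M M' y u v w :
  (forall t, (0 <= t <= 2)%Z -> cell M' t y = cell M t y) ->
  entry M y u v w -> entry M' y u v w.
Proof. by move=> e [c0 c1 c2]; split; rewrite e //; lia. Qed.

Lemma table_ext k p i M M' :
  (forall y t, (0 <= t <= 2)%Z -> cell M' t y = cell M t y) ->
  table k p i M -> table k p i M'.
Proof.
move=> e [t1 t2]; split=> [y /t1 [u [v [w [tr en]]]]|u v w /t2 [y ly en]].
  by exists u, v, w; split=> //; apply: entry_ext en => t; apply: e.
by exists y => //; apply: entry_ext en => t; apply: e.
Qed.

(** Entry [b * L + y] joins digit [b] of the new client to old entry [y]; Euclidean division by [L]
    recovers both. *)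
Lemma table_extend k p i M M' :
  table k p i M ->
  (forall b y t, b < (2 * k).+1 -> y < (2 * k).+1 ^ i -> (0 <= t <= 2)%Z ->
     cell M' t (b * (2 * k).+1 ^ i + y)
     = (cell M t y + offset (4 * k.+1 ^ i) (p i) b t)%Z) ->
  table k p i.+1 M'.
Proof.
set L := (2 * k).+1 ^ i => -[t1 t2] new.
have entry_new b y u v w : b < (2 * k).+1 -> y < L -> entry M y u v w ->
    entry M' (b * L + y) (u + b./2 * k.+1 ^ i) (v + uphalf b * k.+1 ^ i)
      (w + odd b * p i).
  move=> lb ly [e0 e1 e2]; split; rewrite new //; try lia.
  - by rewrite e0 /offset /=; lia.
  - by rewrite e1 /offset /=; lia.
  - by rewrite e2 /offset /=; lia.
split=> [y|u v w [b [u' [v' [w' [lb tr -> -> ->]]]]]]; last first.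
  have [y ly en] := t2 _ _ _ tr.
  exists (b * L + y); last by apply: entry_new.
  by rewrite expnS -/L; have := leq_mul (lb : b < (2 * k).+1) (leqnn L); lia.
rewrite expnS -/L => ly.
have L0 : 0 < L by rewrite expn_gt0.
have [u [v [w [tr en]]]] := t1 (y %% L) (ltn_pmod _ L0).
have lb : y %/ L < (2 * k).+1 by rewrite ltn_divLR.
exists (u + (y %/ L)./2 * k.+1 ^ i), (v + uphalf (y %/ L) * k.+1 ^ i).
exists (w + odd (y %/ L) * p i); split; first by exists (y %/ L), u, v, w.
by rewrite {1}(divn_eq y L); apply: entry_new => //; apply: ltn_pmod.
Qed.

(** [rP] only ever advances: the input stores the processing times day by day, in the order in which
    they are read. *)
Definition client_body : com :=
  Seq (Blk [:: ISub rI rI rONE; ILoad rPW rP; IAdd rP rP rONE;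
               IConst rOFF0 0; IConst rOFF1 0; IConst rOFF2 0;
               IConst rWP (-100); IAdd rA rDIG rZERO; IConst rNLEN 0])
 (Seq (While rA digit_body)
      (Blk [:: IAdd rLEN rNLEN rZERO; IAdd rQ rOFF1 rZERO])).

Definition client_regs : seq Z := rI :: rPW :: rP :: rLEN :: rQ :: extend_regs.

Lemma wp_clients k n (p : nat -> nat) a M :
  M rONE = 1%Z -> M rZERO = 0%Z -> M rDIG = Z.of_nat (2 * k).+1 ->
  M rI = Z.of_nat n -> M rP = Z.of_nat a -> M rLEN = 1%Z -> M rQ = 4%Z ->
  (forall i, i < n -> M (Z.of_nat (a + i)) = Z.of_nat (p i)) ->
  table k p 0 M ->
  wp (While rI client_body)
     (\sum_(i < n) ((2 * k).+1 * ((2 * k).+1 ^ i * 20 + 12) + 13 + 2) + 2) M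
   (fun M' =>
    [/\ frame client_regs M M', (forall x, cell M' 3 x = cell M 3 x),
        M' rP = Z.of_nat (a + n), M' rLEN = Z.of_nat ((2 * k).+1 ^ n) /\
        M' rQ = (4 * Z.of_nat (k.+1 ^ n))%Z & table k p n M']).
Proof.
move=> M1 M0 MD MI MP ML MQ MIn MT.
pose Inv i M' := M' rI = Z.of_nat (n - i) /\
    [/\ frame client_regs M M', (forall x, cell M' 3 x = cell M 3 x),
        M' rP = Z.of_nat (a + i), M' rLEN = Z.of_nat ((2 * k).+1 ^ i) /\
        M' rQ = (4 * Z.of_nat (k.+1 ^ i))%Z & table k p i M'].
apply: (@wp_while Inv (fun i => (2 * k).+1 * ((2 * k).+1 ^ i * 20 + 12) + 13)).
- by split; rewrite ?subn0 ?addn0.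
- move=> i M' lti [M'I [fr R M'P [M'L M'Q] tab]].
  split; first by lia.
  have M'1 : M' rONE = 1%Z by rewrite fr.2.
  have M'0 : M' rZERO = 0%Z by rewrite fr.2.
  have M'D : M' rDIG = Z.of_nat (2 * k).+1 by rewrite fr.2.
  have M'IN : M' (Z.of_nat (a + i)) = Z.of_nat (p i) by rewrite fr.1 ?MIn //; lia.
  set L := (2 * k).+1 ^ i in M'L tab *.
  have -> : (2 * k).+1 * (L * 20 + 12) + 13
      = 9 + (((2 * k).+1 * (L * 20 + 12) + 2) + 2).
    by lia.
  apply: wp_seq; apply: (@wp_blk [:: _; _; _; _; _; _; _; _; _]) => //.
  symex.
  set M1' := upd _ _ _.
  have fr1 : frame client_regs M M1' by frames.
  apply: wp_seq; apply: (wp_weaken (leqnn _)).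
    apply: (@wp_extend L (2 * k).+1 (4 * k.+1 ^ i) (p i));
      by rewrite /M1'; upds; try done; lia.
  move=> M2 [fr2 R2 M2NL M2O1 M2new].
  have rg r : (-100 < r < 0)%Z -> has (Z.eqb r) extend_regs = false ->
      M2 r = M1' r by apply: fr2.2.
  have M20 : M2 rZERO = 0%Z by rewrite rg // /M1'; upds.
  have M2I : M2 rI = Z.of_nat (n - i.+1) by rewrite rg // /M1'; upds; lia.
  have M2P : M2 rP = Z.of_nat (a + i.+1) by rewrite rg // /M1'; upds; lia.
  have cM1 t y : (0 <= t <= 3)%Z -> cell M1' t y = cell M' t y.
    by move=> tt; rewrite /cell /M1'; upds.
  clearbody M1'.
  apply: (@wp_blk [:: _; _]) => //.
  symex.
  have halfD : uphalf (2 * k).+1 = k.+1 by rewrite mul2n /= doubleK.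
  split; first by upds.
  split.
  + apply: frame_trans fr1 _.
    have fr3 : frame client_regs M1' M2 by apply: frame_sub fr2.
    by frames.
  + by move=> x; rewrite -R -cM1 // -R2 /cell; upds.
  + by upds.
  + by split; upds; rewrite ?halfD expnS ?Z.add_0_r //; lia.
  + apply: (@table_ext _ _ _ M2); first by move=> y t tt; rewrite /cell; upds.
    apply: (table_extend tab) => b y t lb ly tt.
    by rewrite M2new // cM1 //; lia.
- move=> M' [M'I H]; split; [lia|exact: H].
Qed.

(** * The dynamic program *)

(** The same shape as the verdict in [decides_in], so that the last flag read is the answer. *)
Definition flag (z : Z) (P : Prop) : Prop := z = 1%Z /\ P \/ z = 0%Z /\ ~ P.

Lemma flag_iff z (P Q : Prop) : (P <-> Q) -> flag z P -> flag z Q.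
Proof. by rewrite /flag; tauto. Qed.

Fixpoint reach (n k : nat) (p : nat -> nat -> nat) (d : nat -> nat) (j v : nat)
    : Prop :=
  match j with
  | 0 => v = 0
  | j'.+1 => exists u w,
      [/\ reach n k p d j' u, trans k (p j') n u v w & w <= d j']
  end.

(** The machine can only test for positive values, hence [rLIM] holds the deadline plus one. Stored
    codes are already scaled by the stride, so subtracting one from the address of a row gives the
    address of its flag. *)
Definition test_entry : com :=
  Seq (Blk [:: ISub rC rC rONE; ILoad rT rRP; ISub rT rROW rT; ILoad rT rT;
               ISub rU rRP rTWO; ILoad rU rU; ISub rU rLIM rU])
 (Seq (If rT (If rU (Blk [:: ISub rU rRP rONE; ILoad rU rU;
                             ISub rU rNEXT rU; IStore rU rONE])))
      (Blk [:: ISub rRP rRP rFOUR])).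

(** Keeps the flags read and written within the rows of the day: both digits [b./2] and [uphalf b]
    are at most [k]. *)
Lemma trans_lt k p i u v w :
  trans k p i u v w -> u < k.+1 ^ i /\ v < k.+1 ^ i.
Proof.
elim: i u v w => [|i IH] u v w /=; first by case=> -> ->.
move=> [b [u' [v' [w' [lb /IH [lu lv] -> -> _]]]]].
have b1 : b./2 <= k by lia.
have b2 : uphalf b <= k by lia.
by rewrite expnS; split; nia.
Qed.

(** The address behind [cell M 3 r]. *)
Definition row (r : nat) : Z := (-103 - 4 * Z.of_nat r)%Z.

Lemma wp_tests k n p j d (pre : nat -> Prop) M :
  let N := k.+1 ^ n in let L := (2 * k).+1 ^ n in
  M rONE = 1%Z -> M rTWO = 2%Z -> M rFOUR = 4%Z -> M rRP = (-100)%Z ->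
  M rC = Z.of_nat L -> M rROW = row (j * N) -> M rNEXT = row (j.+1 * N) ->
  M rLIM = (Z.of_nat d + 1)%Z -> table k p n M ->
  (forall x, x < N -> flag (cell M 3 (j * N + x)) (pre x)) ->
  (forall x, j.+1 * N <= x -> cell M 3 x = 0%Z) ->
  wp (While rC test_entry) (L * 18 + 2) M
   (fun M' =>
    [/\ frame [:: rC; rT; rU; rRP] M M',
       (forall x, x < N -> flag (cell M' 3 (j.+1 * N + x))
          (exists u w, [/\ pre u, trans k p n u x w & w <= d])) &
       (forall x, j.+2 * N <= x -> cell M' 3 x = 0%Z)]).
Proof.
move=> N L Mone Mtwo Mfour MRP MC MR MN ML [tab1 tab2] Mpre Mz.
(* What the flag of [x] in the next row means after [c] entries; that row starts at zero and its
   flags are only ever raised. *)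
pose hit c x := exists y u w, [/\ y < c, entry M y u x w & pre u /\ w <= d].
pose Inv c M' := M' rC = Z.of_nat (L - c) /\ M' rRP = (-100 - 4 * Z.of_nat c)%Z /\
  [/\ frame [:: rC; rT; rU; rRP] M M',
     (forall y t, (0 <= t <= 2)%Z -> cell M' t y = cell M t y),
     (forall x, x < N -> cell M' 3 (j * N + x) = cell M 3 (j * N + x)),
     (forall x, x < N -> flag (cell M' 3 (j.+1 * N + x)) (hit c x)) &
     (forall x, j.+2 * N <= x -> cell M' 3 x = 0%Z)].
have -> : L * 18 + 2 = \sum_(i < L) (16 + 2) + 2.
  by rewrite sum_nat_const card_ord.
apply: (@wp_while Inv (fun=> 16)).
- split; first by rewrite subn0.
  split=> //; split=> //.
  + move=> x lx; right; split; first by apply: Mz; lia.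
    by move=> [y [u [w []]]].
  + by move=> x lx; apply: Mz; lia.
- move=> c M' ltc [M'C [M'RP [fr cells cur nxt zs]]].
  split; first by lia.
  have M'1 : M' rONE = 1%Z by rewrite fr.2.
  have M'2 : M' rTWO = 2%Z by rewrite fr.2.
  have M'4 : M' rFOUR = 4%Z by rewrite fr.2.
  have M'R : M' rROW = row (j * N) by rewrite fr.2.
  have M'N : M' rNEXT = row (j.+1 * N) by rewrite fr.2.
  have M'L : M' rLIM = (Z.of_nat d + 1)%Z by rewrite fr.2.
  have [u [v [w [tr en]]]] := tab1 c ltc.
  have [lu lv] := trans_lt tr; rewrite -/N in lu lv.
  have [c0 c1 c2] : entry M' c u v w by apply: entry_ext en => t; apply: cells.
  have M'c0 : M' (-100 - 4 * Z.of_nat c)%Z = (4 * Z.of_nat u)%Z.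
    by rewrite -c0; congr (M' _); lia.
  have M'c1 : M' (-100 - 4 * Z.of_nat c - 1)%Z = (4 * Z.of_nat v)%Z.
    by rewrite -c1; congr (M' _); lia.
  have M'c2 : M' (-100 - 4 * Z.of_nat c - 2)%Z = Z.of_nat w.
    by rewrite -c2; congr (M' _); lia.
  have M'u : M' (row (j * N) - 4 * Z.of_nat u)%Z = cell M 3 (j * N + u).
    by rewrite -cur // /cell; congr (M' _); rewrite /row; lia.
  have rowj r : (row r <= -103)%Z by rewrite /row; lia.
  (* Memory determines the components of entry [c], so this entry can only affect the flag of
     [v]. *)
  have en_c u' x w' : entry M c u' x w' -> [/\ u' = u, x = v & w' = w].
    by case: en => e0 e1 e2 [e0' e1' e2']; split; lia.
  have hitS x : hit c x -> hit c.+1 x.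
    by move=> [y [u' [w' [ly en' H]]]]; exists y, u', w'; split=> //; lia.
  have hitSv : hit c.+1 v <-> hit c v \/ pre u /\ w <= d.
    split=> [[y [u' [w' [ly en' H]]]]|[/hitS//|H]]; last by exists c, u, w.
    have [yc|yc] := eqVneq y c.
      by rewrite yc in en'; have [<- _ <-] := en_c _ _ _ en'; right.
    by left; exists y, u', w'; split=> //; lia.
  have hitSx x : x <> v -> hit c x <-> hit c.+1 x.
    move=> xv; split=> [/hitS//|[y [u' [w' [ly en' H]]]]].
    have [yc|yc] := eqVneq y c; last by exists y, u', w'; split=> //; lia.
    by rewrite yc in en'; have [_ /xv] := en_c _ _ _ en'.
  change 16 with (7 + ((4 + 2 + 2) + 1)).
  apply: wp_seq; apply: (@wp_blk [:: _; _; _; _; _; _; _]) => //.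
  have rj := rowj (j * N).
  symex.
  set M1' := upd _ _ _.
  have fr1 : frame [:: rC; rT; rU; rRP] M M1' by frames.
  have cM1 t y : (0 <= t <= 3)%Z -> cell M1' t y = cell M' t y.
    by move=> tt; rewrite /cell /M1'; upds.
  have M1T : M1' rT = cell M 3 (j * N + u) by rewrite /M1'; upds.
  have M1U : M1' rU = (Z.of_nat d + 1 - Z.of_nat w)%Z by rewrite /M1'; upds.
  have M11 : M1' rONE = 1%Z by rewrite fr1.2.
  have M1N : M1' rNEXT = row (j.+1 * N) by rewrite fr1.2.
  have M14 : M1' rFOUR = 4%Z by rewrite fr1.2.
  have M1RP : M1' rRP = (-100 - 4 * Z.of_nat c)%Z by rewrite /M1'; upds.
  have M1C : M1' rC = Z.of_nat (L - c.+1) by rewrite /M1'; upds; lia.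
  have M1c1 : M1' (-100 - 4 * Z.of_nat c - 1)%Z = (4 * Z.of_nat v)%Z.
    by rewrite /M1'; upds.
  clearbody M1'.
  pose target := j.+1 * N + v.
  (* Common outcome of the branches: at most the target flag has changed, and it now accounts for
     entry [c]. *)
  pose Mid M2 := [/\ frame [:: rU] M1' M2,
    forall y t, (0 <= t <= 2)%Z -> cell M2 t y = cell M1' t y,
    forall x, x <> target -> cell M2 3 x = cell M1' 3 x &
    flag (cell M2 3 target) (hit c.+1 v)].
  have old : ~ (pre u /\ w <= d) -> flag (cell M1' 3 target) (hit c.+1 v).
    by move=> no; rewrite cM1 //; apply: flag_iff (nxt v lv); rewrite hitSv; tauto.
  apply: wp_seq; apply: (@wp_weaken _ _ _ _ Mid _ (leqnn _)).
  + apply: wp_if; last first.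
      move=> T0; split=> //; apply: old => -[pu _].
      by case: (Mpre u lu) => -[]; [lia | tauto].
    move=> T0; apply: wp_if; last by move=> U0; split=> //; apply: old; lia.
    move=> U0.
    have pu : pre u by case: (Mpre u lu) => -[]; [| lia].
    have rj1 := rowj (j.+1 * N).
    apply: (@wp_blk [:: _; _; _; _]) => //.
    symex.
    split.
    * by frames.
    * by move=> y t tt; rewrite /cell /row; upds.
    * by move=> x xt; rewrite /cell /row; upds.
    * left; split; first by rewrite /cell /row /target; upds.
      by apply/hitSv; right; split=> //; lia.
  + move=> M2 [fr2 cM2 oM2 flM2].
    have M24 : M2 rFOUR = 4%Z by rewrite fr2.2.
    have M2RP : M2 rRP = (-100 - 4 * Z.of_nat c)%Z by rewrite fr2.2.
    have M2C : M2 rC = Z.of_nat (L - c.+1) by rewrite fr2.2.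
    apply: (@wp_blk [:: _]) => //.
    symex.
    have cM3 t y v' : (0 <= t <= 3)%Z -> cell (upd M2 rRP v') t y = cell M2 t y.
      by move=> tt; rewrite /cell; upds.
    split; first by upds.
    split; first by upds; lia.
    split.
    * apply: frame_trans fr1 _.
      have fr3 : frame [:: rC; rT; rU; rRP] M1' M2 by apply: frame_sub fr2.
      by frames.
    * by move=> y t tt; rewrite cM3 ?cM2 ?cM1 ?cells //; lia.
    * by move=> x lx; rewrite cM3 // oM2 ?cM1 ?cur // /target; lia.
    * move=> x lx; rewrite cM3 //.
      have [->//|/eqP xv] := eqVneq x v.
      rewrite oM2 ?cM1 //; first by apply: flag_iff (hitSx x xv) (nxt x lx).
      by rewrite /target; lia.
    * by move=> x lx; rewrite cM3 // oM2 ?cM1 ?zs // /target; lia.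
- move=> M' [M'C [_ [fr cells _ nxt zs]]].
  split; first by lia.
  split=> // x lx; apply: flag_iff (nxt x lx); split.
  + move=> [y [u [w [ly en [pu wd]]]]].
    have [u' [v' [w' [tr [e0 e1 e2]]]]] := tab1 y ly.
    case: en => e0' e1' e2'; exists u, w; split=> //.
    by move: tr; congr trans; lia.
  + move=> [u [w [pu /tab2 [y ly en] wd]]].
    by exists y, u, w.
Qed.

(** The list restarts as the single zero entry with weight [4]. After the loop over the clients [rQ]
    is [4 * (k + 1) ^ n], which is also the spacing of two rows, so it locates the next row. A fresh
    row per day means that no flag has to be cleared. *)
Definition day_body : com :=
  Seq (Blk [:: ISub rJ rJ rONE; ILoad rLIM rD; IAdd rLIM rLIM rONE;
               IAdd rD rD rONE; IConst rT (-100); IStore rT rZERO;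
               IConst rT (-101); IStore rT rZERO; IConst rT (-102);
               IStore rT rZERO; IConst rLEN 1; IConst rQ 4; IAdd rI 0 rZERO])
 (Seq (While rI client_body)
 (Seq (Blk [:: ISub rNEXT rROW rQ; IConst rRP (-100); IAdd rC rLEN rZERO])
 (Seq (While rC test_entry)
      (Blk [:: IAdd rROW rNEXT rZERO])))).

Definition day_regs : seq Z :=
  [:: rJ; rLIM; rD; rU; rNEXT; rROW] ++ client_regs.

Definition clients_cost (k n : nat) : nat :=
  \sum_(i < n) ((2 * k).+1 * ((2 * k).+1 ^ i * 20 + 12) + 13 + 2) + 2.

Definition day_cost (k n : nat) : nat :=
  13 + (clients_cost k n + (3 + (((2 * k).+1 ^ n * 18 + 2) + 1))).

Lemma wp_days n m k (p : nat -> nat -> nat) (d : nat -> nat) M :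
  let N := k.+1 ^ n in
  M rONE = 1%Z -> M rTWO = 2%Z -> M rFOUR = 4%Z -> M rZERO = 0%Z ->
  M rDIG = Z.of_nat (2 * k).+1 -> M rP = 3%Z -> M rD = Z.of_nat (3 + m * n) ->
  M rJ = Z.of_nat m -> M rROW = row 0 ->
  cell M 3 0 = 1%Z -> (forall x, 0 < x -> cell M 3 x = 0%Z) ->
  M 0%Z = Z.of_nat n ->
  (forall j i, j < m -> i < n ->
     M (Z.of_nat (3 + j * n + i)) = Z.of_nat (p j i)) ->
  (forall j, j < m -> M (Z.of_nat (3 + m * n + j)) = Z.of_nat (d j)) ->
  wp (While rJ day_body) (m * (day_cost k n + 2) + 2) M
   (fun M' =>
    [/\ frame day_regs M M', M' rROW = row (m * N),
       m = 0 \/ M' rQ = (4 * Z.of_nat N)%Z &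
       forall x, x < N -> flag (cell M' 3 (m * N + x)) (reach n k p d m x)]).
Proof.
move=> N Mone Mtwo Mfour Mzero MDIG MP MD MJ MROW M30 M3 Mn Mp Md.
(* All rows after row [j] are still zero. Before the first day [rQ] has no useful value, whence the
   alternative [j = 0]. *)
pose Inv j M' := M' rJ = Z.of_nat (m - j) /\
  M' rP = Z.of_nat (3 + j * n) /\ M' rD = Z.of_nat (3 + m * n + j) /\
  (forall x, j.+1 * N <= x -> cell M' 3 x = 0%Z) /\
    [/\ frame day_regs M M', M' rROW = row (j * N),
       j = 0 \/ M' rQ = (4 * Z.of_nat N)%Z &
       forall x, x < N -> flag (cell M' 3 (j * N + x)) (reach n k p d j x)].
have N0 : 0 < N by rewrite expn_gt0.
have -> : m * (day_cost k n + 2) + 2 = \sum_(i < m) (day_cost k n + 2) + 2.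
  by rewrite sum_nat_const card_ord.
apply: (@wp_while Inv (fun=> day_cost k n)).
- rewrite /Inv subn0 addn0 mul0n; split=> //; split=> //; split=> //.
  split; first by move=> x; rewrite mul1n => lx; apply: M3; lia.
  split=> //; first by left.
  move=> x lx; have [->|x0] := posnP x; first by left.
  by right; rewrite M3 //=; split=> //; lia.
- move=> j M' ltj [M'J [M'P [M'D [zs [fr M'R _ fl]]]]].
  split; first by lia.
  have M'1 : M' rONE = 1%Z by rewrite fr.2.
  have M'0 : M' rZERO = 0%Z by rewrite fr.2.
  have M'n : M' 0%Z = Z.of_nat n by rewrite fr.1.
  have M'd : M' (Z.of_nat (3 + m * n + j)) = Z.of_nat (d j).
    by rewrite fr.1 ?Md //; lia.
  rewrite /day_cost.
  apply: wp_seq; apply: (@wp_blk [:: _; _; _; _; _; _; _; _; _; _; _; _; _]) => //.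
  symex.
  set M1 := upd _ _ _.
  have fr1 : frame day_regs M' M1 by frames.
  have c3M1 x : cell M1 3 x = cell M' 3 x by rewrite /cell /M1; upds.
  have M1rg r : (-100 < r < 0)%Z ->
      has (Z.eqb r) [:: rJ; rLIM; rD; rT; rLEN; rQ; rI] = false -> M1 r = M' r.
    move=> rr rl.
    by have [_ ->] : frame [:: rJ; rLIM; rD; rT; rLEN; rQ; rI] M' M1 by frames.
  have M1J : M1 rJ = Z.of_nat (m - j.+1) by rewrite /M1; upds; lia.
  have M1LIM : M1 rLIM = (Z.of_nat (d j) + 1)%Z by rewrite /M1; upds.
  have M1D : M1 rD = Z.of_nat (3 + m * n + j.+1) by rewrite /M1; upds; lia.
  have M1ROW : M1 rROW = row (j * N) by rewrite M1rg.
  have M1tab : table k (p j) 0 M1.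
    have en : entry M1 0 0 0 0 by split; rewrite /cell /M1; upds.
    split=> [y|u v w [-> -> ->]]; last by exists 0; rewrite ?expn0.
    by rewrite expn0 ltnS leqn0 => /eqP ->; exists 0, 0, 0.
  have M1L : M1 rLEN = 1%Z by rewrite /M1; upds.
  have M1Q : M1 rQ = 4%Z by rewrite /M1; upds.
  have M1I : M1 rI = Z.of_nat n by rewrite /M1; upds; lia.
  clearbody M1.
  apply: wp_seq; apply: (wp_weaken (leqnn _)).
    apply: (@wp_clients k n (p j) (3 + j * n)) => //.
    + by rewrite M1rg.
    + by rewrite M1rg.
    + by rewrite M1rg // fr.2.
    + by rewrite M1rg.
    + by move=> i lti; rewrite fr1.1 ?fr.1 ?Mp //; lia.
  move=> M2 [fr2 c3M2 M2P [M2L M2Q] M2tab].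
  have rg2 r : (-100 < r < 0)%Z -> has (Z.eqb r) client_regs = false ->
      M2 r = M1 r by apply: fr2.2.
  have M2ROW : M2 rROW = row (j * N) by rewrite rg2.
  have M20 : M2 rZERO = 0%Z by rewrite rg2 // M1rg.
  have M21 : M2 rONE = 1%Z by rewrite rg2 // M1rg.
  have M22 : M2 rTWO = 2%Z by rewrite rg2 // M1rg // fr.2.
  have M24 : M2 rFOUR = 4%Z by rewrite rg2 // M1rg // fr.2.
  have M2LIM : M2 rLIM = (Z.of_nat (d j) + 1)%Z by rewrite rg2.
  have M2J : M2 rJ = Z.of_nat (m - j.+1) by rewrite rg2.
  have M2D : M2 rD = Z.of_nat (3 + m * n + j.+1) by rewrite rg2.
  apply: wp_seq; apply: (@wp_blk [:: _; _; _]) => //.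
  symex.
  set M3' := upd _ _ _.
  have fr3 : frame day_regs M2 M3' by frames.
  have cM3 t x : (0 <= t <= 3)%Z -> cell M3' t x = cell M2 t x.
    by move=> tt; rewrite /cell /M3'; upds.
  have M3NEXT : M3' rNEXT = row (j.+1 * N) by rewrite /M3' /row; upds; lia.
  have M3rg r : (-100 < r < 0)%Z ->
      has (Z.eqb r) [:: rNEXT; rRP; rC] = false -> M3' r = M2 r.
    by move=> rr rl; have [_ ->] : frame [:: rNEXT; rRP; rC] M2 M3' by frames.
  have M3RP : M3' rRP = (-100)%Z by rewrite /M3'; upds.
  have M3C : M3' rC = Z.of_nat ((2 * k).+1 ^ n) by rewrite /M3'; upds; lia.
  clearbody M3'.
  apply: wp_seq; apply: (wp_weaken (leqnn _)).
    apply: (@wp_tests k n (p j) j (d j) (reach n k p d j)) => //.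
    + by rewrite M3rg.
    + by rewrite M3rg.
    + by rewrite M3rg.
    + by rewrite M3rg.
    + by rewrite M3rg.
    + by apply: table_ext M2tab => y t tt; apply: cM3; lia.
    + by move=> x lx; rewrite cM3 // c3M2 c3M1; apply: fl.
    + by move=> x lx; rewrite cM3 // c3M2 c3M1; apply: zs.
  move=> M4 [fr4 fl4 zs4].
  have rg4 r : (-100 < r < 0)%Z -> has (Z.eqb r) [:: rC; rT; rU; rRP] = false ->
      M4 r = M3' r by apply: fr4.2.
  have M40 : M4 rZERO = 0%Z by rewrite rg4 // M3rg.
  have M4N : M4 rNEXT = row (j.+1 * N) by rewrite rg4.
  apply: (@wp_blk [:: _]) => //.
  symex.
  have M4rg r v : (-100 < r < 0)%Z -> has (Z.eqb r) [:: rROW] = false ->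
      upd M4 rROW v r = M4 r.
    by move=> rr rl; have [_ ->] : frame [:: rROW] M4 (upd M4 rROW v) by frames.
  have c3M4 x v : cell (upd M4 rROW v) 3 x = cell M4 3 x by rewrite /cell; upds.
  split; first by rewrite M4rg // rg4 // M3rg.
  split; first by rewrite M4rg // rg4 // M3rg // M2P; lia.
  split; first by rewrite M4rg // rg4 // M3rg.
  split; first by move=> x lx; rewrite c3M4; apply: zs4.
  split.
  + apply: frame_trans fr _; apply: frame_trans fr1 _.
    have fr2' : frame day_regs M1 M2 by apply: frame_sub fr2.
    have fr4' : frame day_regs M3' M4 by apply: frame_sub fr4.
    apply: frame_trans fr2' _; apply: frame_trans fr3 _.
    by frames.
  + by upds; rewrite /row; lia.
  + by right; rewrite M4rg // rg4 // M3rg.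
  + by move=> x lx; rewrite c3M4; apply: fl4.
- move=> M' [M'J [_ [_ [_ H]]]]; split; [lia|exact: H].
Qed.

(** Cell [0] holds [n]; [m] such additions bring [rD] to [3 + m * n], where the deadlines begin. *)
Definition skip_jobs : com :=
  Blk [:: IAdd rD rD 0; ISub rJ rJ rONE].

(** The operands [1] and [2] of [IAdd] are the addresses of [m] and [k], so [rDIG] becomes [2k + 1].
    The answer is the last flag of the last row, that of the code [(k + 1) ^ n - 1]. *)
Definition dynamic_program : com :=
  Seq (Blk [:: IConst rONE 1; IConst rTWO 2; IConst rFOUR 4; IAdd rDIG 2 2;
               IAdd rDIG rDIG rONE; IConst rP 3; IConst rD 3; IAdd rJ 1 rZERO])
 (Seq (While rJ skip_jobs)
 (Seq (Blk [:: IConst rT (-103); IStore rT rONE; IConst rROW (-103);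
               IAdd rJ 1 rZERO])
 (Seq (While rJ day_body)
      (Blk [:: ISub rT rROW rQ; IAdd rT rT rFOUR; ILoad rANS rT])))).

(** For [k = 0] the answer is yes at once. Otherwise [k <= m] gives at least one day, so [rQ] is set
    when the final flag is located. Cell [0] is overwritten only at the end, since every day reads
    [n] from it. *)
Definition solver : com :=
  Seq (Blk [:: IConst rANS 1])
 (Seq (If 2 dynamic_program)
      (Blk [:: IAdd 0 rANS rZERO])).

Definition solver_cost (k n m : nat) : nat :=
  1 + (8 + (m * 4 + 2 + (4 + (m * (day_cost k n + 2) + 2 + 3))) + 2 + 1).

Lemma wp_solver n m k (p : nat -> nat -> nat) (d : nat -> nat) M :
  k <= m ->
  (forall a, (a < 0)%Z -> M a = 0%Z) ->
  M 0%Z = Z.of_nat n -> M 1%Z = Z.of_nat m -> M 2%Z = Z.of_nat k ->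
  (forall j i, j < m -> i < n ->
     M (Z.of_nat (3 + j * n + i)) = Z.of_nat (p j i)) ->
  (forall j, j < m -> M (Z.of_nat (3 + m * n + j)) = Z.of_nat (d j)) ->
  wp solver (solver_cost k n m) M
    (fun M' => flag (M' 0%Z) (k = 0 \/ reach n k p d m (k.+1 ^ n).-1)).
Proof.
move=> km Mneg Mn Mm Mk Mp Md.
pose N := k.+1 ^ n.
have N0 : 0 < N by rewrite expn_gt0.
have z r : (r < 0)%Z -> M r = 0%Z by apply: Mneg.
apply: wp_seq; apply: (@wp_blk [:: _]) => //; symex.
set M1 := upd _ _ _.
have M1pos a : (0 <= a)%Z -> M1 a = M a by move=> a0; rewrite /M1; upds.
have M1neg a : (a < 0)%Z -> a <> rANS -> M1 a = 0%Z.
  by move=> a0 na; rewrite /M1; upds; apply: Mneg.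
have M1ANS : M1 rANS = 1%Z by rewrite /M1; upds.
clearbody M1.
pose Q M' := M' rZERO = 0%Z /\ flag (M' rANS) (k = 0 \/ reach n k p d m N.-1).
apply: wp_seq; apply: (@wp_weaken _ _ _ _ Q _ (leqnn _)); last first.
  move=> M2 [M20 M2ANS]; apply: (@wp_blk [:: _]) => //; symex.
  by upds; rewrite Z.add_0_r.
apply: wp_if => k0; last first.
  split; first by rewrite M1neg.
  by left; split=> //; left; move: k0; rewrite M1pos // Mk; lia.
rewrite M1pos // Mk in k0.
have M10 : M1 rZERO = 0%Z by rewrite M1neg.
have M1k : M1 2%Z = Z.of_nat k by rewrite M1pos.
have M1m : M1 1%Z = Z.of_nat m by rewrite M1pos.
apply: wp_seq; apply: (@wp_blk [:: _; _; _; _; _; _; _; _]) => //; symex.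
set M2 := upd _ _ _.
have fr2 : frame [:: rONE; rTWO; rFOUR; rDIG; rP; rD; rJ] M1 M2 by frames.
have M2J : M2 rJ = Z.of_nat m by rewrite /M2; upds; lia.
have M2D : M2 rD = 3%Z by rewrite /M2; upds.
have M2P : M2 rP = 3%Z by rewrite /M2; upds.
have M2DIG : M2 rDIG = Z.of_nat (2 * k).+1 by rewrite /M2; upds; lia.
have M2one : M2 rONE = 1%Z by rewrite /M2; upds.
have M2two : M2 rTWO = 2%Z by rewrite /M2; upds.
have M2four : M2 rFOUR = 4%Z by rewrite /M2; upds.
have M2neg a : (a <= -100)%Z -> M2 a = 0%Z.
  by move=> a0; rewrite /M2; upds; apply: M1neg; lia.
have M20 : M2 rZERO = 0%Z by rewrite fr2.2.
clearbody M2.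
pose Inv j M' := [/\ M' rJ = Z.of_nat (m - j), M' rD = Z.of_nat (3 + j * n),
  frame [:: rD; rJ] M2 M' & forall a, (a <= -100)%Z -> M' a = 0%Z].
apply: wp_seq; apply: (@wp_weaken _ (m * 4 + 2) _ _ (Inv m) _ (leqnn _)).
  have -> : m * 4 + 2 = \sum_(i < m) (2 + 2) + 2.
    by rewrite sum_nat_const card_ord.
  apply: (@wp_while Inv (fun=> 2)).
  - by split; rewrite ?subn0.
  - move=> j M' ltj [M'J M'D fr' neg]; split; first by lia.
    have M'n : M' 0%Z = Z.of_nat n by rewrite fr'.1 // fr2.1 // M1pos.
    have M'1 : M' rONE = 1%Z by rewrite fr'.2.
    apply: (@wp_blk [:: _; _]) => //; symex; split.
    + by upds; lia.
    + by upds; lia.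
    + by frames.
    + by move=> a a0; upds; apply: neg.
  - move=> M' H; split=> //; case: H; lia.
move=> M3 [_ M3D fr3 M3neg].
have M31 : M3 rONE = 1%Z by rewrite fr3.2.
have M30 : M3 rZERO = 0%Z by rewrite fr3.2.
have M3m : M3 1%Z = Z.of_nat m by rewrite fr3.1 // fr2.1.
apply: wp_seq; apply: (@wp_blk [:: _; _; _; _]) => //; symex.
set M4 := upd _ _ _.
have fr4 : frame [:: rT; rROW; rJ] M3 M4 by frames.
have M4J : M4 rJ = Z.of_nat m by rewrite /M4; upds; lia.
have M4ROW : M4 rROW = row 0 by rewrite /M4; upds.
have M4row0 : cell M4 3 0 = 1%Z by rewrite /cell /M4; upds.
have M4row x : 0 < x -> cell M4 3 x = 0%Z.
  by move=> x0; rewrite /cell /M4; upds; apply: M3neg; lia.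
clearbody M4.
have M4pos a : (0 <= a)%Z -> M4 a = M a.
  by move=> a0; rewrite fr4.1 // fr3.1 // fr2.1 // M1pos.
apply: wp_seq; apply: (wp_weaken (leqnn _)).
  apply: (@wp_days n m k p d) => //.
  + by rewrite fr4.2 // fr3.2.
  + by rewrite fr4.2 // fr3.2.
  + by rewrite fr4.2 // fr3.2.
  + by rewrite fr4.2 // fr3.2.
  + by rewrite fr4.2 // fr3.2.
  + by rewrite fr4.2 // fr3.2.
  + by rewrite fr4.2.
  + by rewrite M4pos.
  + by move=> j i lj li; rewrite M4pos ?Mp //; lia.
  + by move=> j lj; rewrite M4pos ?Md //; lia.
move=> M5; rewrite -/N => -[fr5 M5ROW M5Q M5fl].
have {}M5Q : M5 rQ = (4 * Z.of_nat N)%Z by case: M5Q => //; lia.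
have M50 : M5 rZERO = 0%Z by rewrite fr5.2 // fr4.2.
have M54 : M5 rFOUR = 4%Z by rewrite fr5.2 // fr4.2 // fr3.2.
have last_neg : (row (m * N) - 4 * Z.of_nat N + 4 <= -100)%Z by rewrite /row; lia.
have last_cell : M5 (row (m * N) - 4 * Z.of_nat N + 4)%Z = cell M5 3 (m * N + N.-1).
  by rewrite /cell; congr (M5 _); rewrite /row; lia.
apply: (@wp_blk [:: _; _; _]) => //; symex; split; first by upds.
upds; apply: flag_iff _ (M5fl N.-1 _); last by rewrite prednK.
by split=> [|[]]; [right| lia|].
Qed.

(** * Reachable codes and equitable schedules *)

Definition enc (k i : nat) (x : nat -> nat) : nat := \sum_(l < i) x l * k.+1 ^ l.

Lemma encS k i x : enc k i.+1 x = enc k i x + x i * k.+1 ^ i.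
Proof. by rewrite /enc big_ord_recr. Qed.

Lemma eq_enc k i x y : (forall l, l < i -> x l = y l) -> enc k i x = enc k i y.
Proof. by move=> e; apply: eq_bigr => l _; rewrite e. Qed.

Lemma enc_lt k i x : (forall l, l < i -> x l <= k) -> enc k i x < k.+1 ^ i.
Proof.
elim: i => [|i IH] xk; first by rewrite /enc big_ord0.
have lt_e : enc k i x < k.+1 ^ i by apply: IH => l li; apply: xk; lia.
by rewrite encS expnS; have := xk i (ltnSn i); nia.
Qed.

(** Uniqueness of base [k + 1] digits: the lower digits encode less than [(k + 1) ^ i], so division
    by this power isolates the top digit. *)
Lemma enc_inj k i x y :
  (forall l, l < i -> x l <= k) -> (forall l, l < i -> y l <= k) ->
  enc k i x = enc k i y -> forall l, l < i -> x l = y l.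
Proof.
elim: i => [//|i IH] xk yk; rewrite !encS => e.
have xk' l : l < i -> x l <= k by move=> li; apply: xk; lia.
have yk' l : l < i -> y l <= k by move=> li; apply: yk; lia.
have lx := enc_lt xk'; have ly := enc_lt yk'.
have exy : x i = y i.
  have := congr1 (divn^~ (k.+1 ^ i)) e.
  by rewrite !divnDMl ?expn_gt0 // !divn_small.
have e' : enc k i x = enc k i y by move: e; rewrite exy; lia.
move=> l; rewrite ltnS leq_eqVlt => /predU1P[->//|li].
exact: IH xk' yk' e' l li.
Qed.

(** Identifies the target of the dynamic program: every client served exactly [k] times. *)
Lemma enc_max k i : enc k i (fun=> k) = (k.+1 ^ i).-1.
Proof.
elim: i => [|i IH]; first by rewrite /enc big_ord0.
have N0 : 0 < k.+1 ^ i by rewrite expn_gt0.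
by rewrite encS IH expnS mulSn; lia.
Qed.

(** Gathers the digits [b = 2x + s] chosen one at a time: [x] counts the earlier services, [s] is
    the set of clients served on the day. *)
Lemma trans_enc k p i u v w :
  trans k p i u v w <-> exists (x : nat -> nat) (s : nat -> bool),
    [/\ forall l, l < i -> x l + s l <= k, u = enc k i x,
        v = enc k i (fun l => x l + s l) & w = \sum_(l < i) s l * p l].
Proof.
elim: i u v w => [|i IH] u v w /=.
  split=> [[-> -> ->]|[x [s [_ -> -> ->]]]]; last by rewrite /enc !big_ord0.
  by exists (fun=> 0), (fun=> false); rewrite /enc !big_ord0.
split.
  move=> [b [u' [v' [w' [lb /IH [x [s [xs -> -> ->]]] -> -> ->]]]]].
  exists (fun l => if l == i then b./2 else x l).
  exists (fun l => if l == i then odd b else s l).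
  have ne l : l < i -> (l == i) = false by move/ltn_eqF.
  split.
  - move=> l; rewrite ltnS leq_eqVlt => /predU1P[->|li]; rewrite ?eqxx ?ne ?xs //.
    by lia.
  - rewrite encS eqxx; congr (_ + _).
    by apply: eq_enc => l li; rewrite ne.
  - rewrite encS eqxx; congr (_ + _ * _); last by lia.
    by apply: eq_enc => l li; rewrite ne.
  - rewrite big_ord_recr /= eqxx; congr (_ + _).
    by apply: eq_bigr => l _; rewrite ne.
move=> [x [s [xs -> -> ->]]]; rewrite !encS big_ord_recr /=.
have xsi := xs i (ltnSn i).
exists (2 * x i + s i), (enc k i x), (enc k i (fun l => x l + s l)).
exists (\sum_(l < i) s l * p l); split; [by lia| | | |].
- by apply/IH; exists x, s; split=> // l li; apply: xs; lia.
- by congr (_ + _ * _); case: (s i) xsi; lia.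
- by congr (_ + _ * _); case: (s i) xsi; lia.
- by congr (_ + _ * _); case: (s i) xsi; lia.
Qed.

Definition served (S : nat -> nat -> bool) (j l : nat) : nat := \sum_(j' < j) S j' l.

Lemma servedS S j l : served S j.+1 l = served S j l + S j l.
Proof. by rewrite /served big_ord_recr. Qed.

Lemma reach_enc n k p d j v :
  reach n k p d j v <-> exists S : nat -> nat -> bool,
    [/\ forall j', j' < j -> \sum_(l < n) S j' l * p j' l <= d j',
        forall l, l < n -> served S j l <= k & v = enc k n (served S j)].
Proof.
elim: j v => [|j IH] v /=.
  have s0 (S : nat -> nat -> bool) l : served S 0 l = 0 by rewrite /served big_ord0.
  have e0 S : enc k n (served S 0) = 0.
    by rewrite /enc big1 // => l _; rewrite s0.
  split=> [->|[S [_ _ ->]]]; last by rewrite e0.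
  by exists (fun _ _ => false); split=> // l _; rewrite s0.
split.
  move=> [u [w [/IH [S [feas cap eu]] /trans_enc [x [s [xs eu' -> ew]]] wd]]].
  have xk l : l < n -> x l <= k by move/xs; lia.
  (* The history [S] and the transition share the code [u], hence have the same counts, and the day
     can be appended to the history. *)
  have ex := enc_inj cap xk (etrans (esym eu) eu').
  pose S' j' := if j' == j then s else S j'.
  have eS' l : served S' j.+1 l = served S j l + s l.
    rewrite servedS {2}/S' eqxx; congr (_ + _).
    by apply: eq_bigr => j' _; rewrite /S' ltn_eqF.
  exists S'; split.
  - move=> j'; rewrite ltnS leq_eqVlt /S' => /predU1P[->|lj].
      by rewrite eqxx -ew.
    by rewrite ltn_eqF // feas.
  - by move=> l ln; rewrite eS' ex // xs.
  - by apply: eq_enc => l ln; rewrite eS' ex.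
move=> [S [feas cap ->]].
have cap' l : l < n -> served S j l + S j l <= k by move/cap; rewrite servedS.
exists (enc k n (served S j)), (\sum_(l < n) S j l * p j l); split.
- apply/IH; exists S; split=> // [j' lj|l /cap']; [apply: feas; lia | lia].
- apply/trans_enc; exists (served S j), (S j); split=> //.
  by apply: eq_enc => l _; rewrite servedS.
- exact: feas.
Qed.

(** * Sets of clients served together and schedules *)

Lemma pvalE n m (p : 'I_n -> 'I_m -> nat) (i : 'I_n) (j : 'I_m) :
  Defs.pval p i j = p i j.
Proof. by rewrite /Defs.pval !valK. Qed.

Lemma dvalE m (d : 'I_m -> nat) (j : 'I_m) : dval d j = d j.
Proof. by rewrite /dval valK. Qed.

Lemma subset_of_card (T : finType) (A : {set T}) k :
  k <= #|A| -> exists2 B : {set T}, B \subset A & #|B| = k.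
Proof.
move=> kA; exists [set x in take k (enum A)].
  by apply/subsetP => x; rewrite inE => /mem_take; rewrite mem_enum.
rewrite cardsE; have /card_uniqP -> : uniq (take k (enum A)).
  by rewrite take_uniq ?enum_uniq.
by rewrite size_takel // -cardE.
Qed.

(** Each client is sent to its index in the list of [A] followed by its complement. *)
Lemma perm_prefix n (A : {set 'I_n}) :
  exists s : {perm 'I_n}, forall i i0, i \in A -> s i0 <= s i -> i0 \in A.
Proof.
pose l := enum A ++ enum (~: A).
have memA i : i \in enum A = (i \in A) by rewrite mem_enum.
have lP i : i \in l by rewrite mem_cat !mem_enum inE orbN.
have uniq_l : uniq l.
  rewrite cat_uniq !enum_uniq andbT /=; apply/hasPn => x.
  by rewrite !mem_enum inE.
have size_l : size l = n.
  by rewrite size_cat -!cardE cardsC card_ord.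
have lt_idx i : index i l < n by rewrite -[X in _ < X]size_l index_mem lP.
have inj : injective (fun i => Ordinal (lt_idx i)).
  by move=> i i' [e]; rewrite -(nth_index i (lP i)) e nth_index.
exists (perm inj) => i i0 iA; rewrite !permE /= !index_cat !memA iA.
case: ifP => // _ le_i.
by have := index_mem i (enum A); rewrite memA iA; lia.
Qed.

(** The member of [A] scheduled last completes after all of [A], so its completion time bounds the
    total. *)
Lemma prefix_satisfied n m (p : 'I_n -> 'I_m -> nat) d sigma j (A : {set 'I_n}) :
  (forall i, i \in A -> satisfied p d sigma i j) -> \sum_(i in A) p i j <= d j.
Proof.
move=> sat; case: (set_0Vmem A) => [->|[i1 i1A]]; first by rewrite big_set0.
case: (arg_maxnP (fun i => val (sigma j i)) i1A) => i iA imax.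
apply: leq_trans (sat i iA); rewrite /completion.
rewrite [X in _ <= X](bigID (mem A)) /=.
apply: leq_trans (leq_addr _ _).
rewrite (eq_bigl (fun i0 => (sigma j i0 <= sigma j i) && (i0 \in A))) // => i0.
by case iA0: (i0 \in A); rewrite ?andbF // andbT; apply/esym/imax.
Qed.

(** Forwards, client [i] keeps a set [B i] of exactly [k] satisfied days, and the clients keeping a
    day fit by [prefix_satisfied]. Backwards, [enc_inj] reads the count [k] off the maximal code,
    and scheduling each day's chosen clients first satisfies them. *)
Lemma ESSD_reach n m k (p : 'I_n -> 'I_m -> nat) (d : 'I_m -> nat) :
  ESSD k p d <->
  reach n k (fun j i => Defs.pval p i j) (dval d) m (k.+1 ^ n).-1.
Proof.
rewrite reach_enc -enc_max; split.
  move=> [sigma eq_sigma].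
  have [B HB] : exists B : 'I_n -> {set 'I_m}, forall i,
      B i \subset [set j | satisfied p d sigma i j] /\ #|B i| = k.
    apply: (@fin_all_exists _ (fun=> {set 'I_m}) (fun i B =>
      B \subset [set j | satisfied p d sigma i j] /\ #|B| = k)) => i.
    by have [B sB cB] := subset_of_card (eq_sigma i); exists B.
  pose S (j l : nat) := match insub l, insub j with
    | Some i, Some j' => (j' : 'I_m) \in B (i : 'I_n) | _, _ => false end.
  have SE (j : 'I_m) (i : 'I_n) : S j i = (j \in B i) by rewrite /S !valK.
  have servedE (i : 'I_n) : served S m i = k.
    rewrite -(HB i).2 -sum1_card [RHS]big_mkcond.
    by apply: eq_bigr => j _; rewrite SE; case: (j \in B i).
  exists S; split=> [j lj|l ln|].
  - rewrite -[j]/(val (Ordinal lj)) dvalE.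
    rewrite (eq_bigr (fun i : 'I_n =>
      if Ordinal lj \in B i then p i (Ordinal lj) else 0)).
      rewrite -big_mkcond (eq_bigl (fun i => i \in [set i | Ordinal lj \in B i])).
        apply: (@prefix_satisfied _ _ _ _ sigma) => i; rewrite inE => jB.
        by have /subsetP/(_ _ jB) := (HB i).1; rewrite inE.
      by move=> i; rewrite inE.
    by move=> i _; rewrite SE pvalE; case: ifP; rewrite ?mul1n.
  - by rewrite -[l]/(val (Ordinal ln)) servedE.
  - by apply: eq_enc => l ln; rewrite -[l]/(val (Ordinal ln)) servedE.
move=> [S [feas cap e]].
have servedE := enc_inj cap (fun _ _ => leqnn k) (esym e).
have [sigma Hs] : exists sigma : 'I_m -> {perm 'I_n},
  forall (j : 'I_m) (i i0 : 'I_n),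
    S j i -> sigma j i0 <= sigma j i -> S j i0.
  apply: (@fin_all_exists _ (fun=> {perm 'I_n}) (fun (j : 'I_m) (s : {perm 'I_n}) =>
    forall i i0 : 'I_n, S j i -> s i0 <= s i -> S j i0)) => j.
  have [s Hs] := perm_prefix [set i : 'I_n | S j i].
  by exists s => i i0; have := Hs i i0; rewrite !inE.
exists sigma => i; rewrite -(servedE i (ltn_ord i)).
apply: (@leq_trans #|[set j : 'I_m | S j i]|).
  rewrite /served -sum1_card [X in _ <= X]big_mkcond.
  by apply: leq_sum => j _; rewrite inE; case: (S j i).
apply/subset_leq_card/subsetP => j; rewrite !inE => Sji.
(* Only chosen clients precede a chosen one, so its completion time is at most the day's chosen
   total. *)
rewrite /satisfied /completion -(dvalE d); apply: leq_trans (feas j (ltn_ord j)).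
rewrite big_mkcond; apply: leq_sum => i0 _; rewrite pvalE.
by case: ifP => // le_s; rewrite (Hs _ _ _ Sji le_s) mul1n.
Qed.

(** * Running time and input encoding *)

Lemma geometric_sum b n : 1 < b -> \sum_(i < n) b ^ i.+1 <= 2 * b ^ n.
Proof.
(* The extra [2] makes the induction close, by [2 * b ^ n <= b ^ n.+1]. *)
move=> b1; have : \sum_(i < n) b ^ i.+1 + 2 <= 2 * b ^ n; last by lia.
elim: n => [|n IH]; first by rewrite big_ord0 expn0.
have := leq_mul b1 (leqnn (b ^ n)).
rewrite big_ord_recr [X in X + _ + _](_ : _ = \sum_(i < n) b ^ i.+1) // expnS.
move: (\sum_(i < n) _) (b ^ n) IH => s e; lia.
Qed.

(** The base is raised from [2k + 1] to [2k + 2] because for [k = 0] the former is [1] and the sum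
    over the clients grows with [n]; a base of at least [2] makes it geometric. *)
Lemma day_cost_le k n : day_cost k n <= 133 * (2 * k + 2) ^ n.
Proof.
set b := 2 * k + 2.
have le_pow i : (2 * k).+1 ^ i <= b ^ i.
  by case: i => [//|i]; rewrite leq_exp2r // /b; lia.
have pow_gt0 i : 0 < b ^ i by rewrite expn_gt0 /b; lia.
(* [47 = 20 + 12 + 13 + 2], each term being absorbed into [b ^ i.+1]. *)
have sum_le : \sum_(i < n) ((2 * k).+1 * ((2 * k).+1 ^ i * 20 + 12) + 13 + 2)
    <= 47 * (2 * b ^ n).
  apply: (@leq_trans (47 * \sum_(i < n) b ^ i.+1)); last first.
    by rewrite leq_mul2l geometric_sum // /b; lia.
  rewrite big_distrr; apply: leq_sum => i _ /=.
  have := le_pow i; have := pow_gt0 i.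
  by rewrite expnS /b; nia.
have := le_pow n; have := pow_gt0 n.
by rewrite /day_cost /clients_cost; lia.
Qed.

(** Per day, [133 + 2] for the main loop and [4] for [skip_jobs]; the additive constant covers the
    steps outside the loops, also when [m = 0]. *)
Lemma solver_cost_le k n m :
  solver_cost k n m <= 139 * ((2 * k + 2) ^ n * m) + 139.
Proof.
have b0 : 0 < (2 * k + 2) ^ n by rewrite expn_gt0; lia.
have := day_cost_le k n; rewrite /solver_cost.
move: (day_cost k n) ((2 * k + 2) ^ n) b0 => c b b0 le_c.
have : m * (c + 2) <= m * (135 * b) by rewrite leq_mul2l; lia.
have : m <= m * b by rewrite leq_pmulr.
by lia.
Qed.

Lemma init_mem_neg n m k (p : 'I_n -> 'I_m -> nat) (d : 'I_m -> nat) a :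
  (a < 0)%Z -> init_mem k p d a = 0%Z.
Proof.
move=> a0; rewrite /init_mem; do ?case: Z.eqb_spec => [|_]; try lia.
by do 2 (case: ifP => [/andP[] | _]; first lia).
Qed.

Lemma init_mem_p n m k (p : 'I_n -> 'I_m -> nat) (d : 'I_m -> nat) j i :
  j < m -> i < n ->
  init_mem k p d (Z.of_nat (3 + j * n + i)) = Z.of_nat (Defs.pval p i j).
Proof.
move=> lj li; rewrite /init_mem; do ?case: Z.eqb_spec => [|_]; try lia.
have lt_nm : j * n + i < n * m by nia.
case: ifP => [_ | ]; last by lia.
have -> : Z.to_nat (Z.of_nat (3 + j * n + i) - 3) = j * n + i by lia.
by rewrite modnMDl modn_small // divnMDl ?divn_small ?addn0 //; lia.
Qed.

Lemma init_mem_d n m k (p : 'I_n -> 'I_m -> nat) (d : 'I_m -> nat) j : j < m ->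
  init_mem k p d (Z.of_nat (3 + m * n + j)) = Z.of_nat (dval d j).
Proof.
move=> lj; rewrite /init_mem; do ?case: Z.eqb_spec => [|_]; try lia.
have := mulnC n m => nm.
case: ifP => [|_]; first by lia.
case: ifP => [_|]; last by lia.
by congr (Z.of_nat (dval d _)); lia.
Qed.

(* There is a single RAM program and a constant c such that, on every ESSD
   instance (n clients, m days, 0 <= k <= m), the program decides the
   instance within c * (2k+2)^n * m (+ c) steps. *)
Theorem theorem5 :
  exists (P : program) (c : nat),
    forall (n m k : nat) (p : 'I_n -> 'I_m -> nat) (d : 'I_m -> nat),
      k <= m ->
      exists t : nat,
        t <= c * ((2 * k + 2) ^ n * m) + c /\ decides_in P k p d t.
Proof.
exists (compile 0 solver), 139 => n m k p d km.
have [M' [t [le_t run fl]]] :=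
  @wp_solver n m k (fun j i => Defs.pval p i j) (dval d) (init_mem k p d) km
    (@init_mem_neg _ _ _ _ _) erefl erefl erefl (@init_mem_p _ _ _ _ _)
    (@init_mem_d _ _ _ _ _).
exists t; split; first exact: leq_trans le_t (solver_cost_le _ _ _).
have := run [::] [::]; rewrite cats0 => e.
rewrite /decides_in /init_state.
rewrite (e : exec (compile 0 solver) t _ = State (csize solver) M').
split; first by rewrite /halted length_size size_compile.
apply: flag_iff fl; rewrite -ESSD_reach; split; last by right.
(* For [k = 0] any schedules will do, here the identity permutations. *)
by case=> [-> | //]; exists (fun=> 1%g).
Qed.
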